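(* Let $\lambda$ be a non-zero real number and let $r$ be a positive integer. For every integer $n\ge 0$, $$\mathcal{E}_{n,\lambda}^{(r)}(x)=n!\sum_{k=0}^{n}\Bigg\{\sum_{\substack{0\le l\le n-k\\ l\ \mathrm{even}}}\frac{(1)_{\frac{l}{2},\lambda}}{k!\,(n-k-l)!\,2^{l+k}\,\big(\frac{l}{2}\big)!}\,\mathcal{E}_{n-k-l,\lambda}^{(r)}\Bigg\}H_{k,\lambda}(x),$$ where $\mathcal{E}_{n,\lambda}^{(r)}(x)$ and $\mathcal{E}_{n,\lambda}^{(r)}=\mathcal{E}_{n,\lambda}^{(r)}(0)$ are the degenerate Euler polynomials and numbers of order $r$, and $H_{k,\lambda}(x)$ are the degenerate Hermite polynomials.
   Context: Fix a non-zero real number $\lambda$. The degenerate falling factorials are $(x)_{0,\lambda}=1$ and $(x)_{n,\lambda}=x(x-\lambda)(x-2\lambda)\cdots(x-(n-1)\lambda)$ for $n\ge 1$. The degenerate exponential functions are $e_\lambda^x(t)=(1+\lambda t)^{x/\lambda}=\sum_{n\ge 0}(x)_{n,\lambda}\frac{t^n}{n!}$, regarded as formal power series in $t$, and $e_\lambda(t)=e_\lambda^1(t)$. The degenerate Hermite polynomials $H_{n,\lambda}(x)$ are defined by $$e_\lambda^{-1}(t^2)\, e_\lambda^{x}(2t)=\sum_{n=0}^\infty H_{n,\lambda}(x)\frac{t^n}{n!}.$$ The degenerate Euler polynomials of order $r$ are defined by $$\bigg(\frac{2}{e_\lambda(t)+1}\bigg)^{r}e_\lambda^x(t)=\sum_{n=0}^\infty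 \mathcal{E}_{n,\lambda}^{(r)}(x)\frac{t^n}{n!},$$ and $\mathcal{E}_{n,\lambda}^{(r)}=\mathcal{E}_{n,\lambda}^{(r)}(0)$ are the degenerate Euler numbers of order $r$. *)

(* Defs.v *)
From HB Require Import structures.
From mathcomp Require Import all_boot all_order all_algebra.
From mathcomp Require Import boolp reals.

Set Implicit Arguments.
Unset Strict Implicit.
Unset Printing Implicit Defensive.

Import Order.TTheory GRing.Theory Num.Theory.
Local Open Scope ring_scope.

Record fps (A : Type) := FPS { fps_coef : nat -> A }.

HB.instance Definition _ (A : Type) := gen_eqMixin (fps A).
HB.instance Definition _ (A : Type) := gen_choiceMixin (fps A).

Lemma fpsP (A : Type) (f g : fps A) :
  (forall n, fps_coef f n = fps_coef g n) -> f = g.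
Proof. by case: f g => [f] [g] /= fg; congr FPS; apply/funext. Qed.

Section FpsRing.
Variable A : comNzRingType.
Implicit Types f g h : fps A.

Definition fps_zero : fps A := FPS (fun _ => 0).
Definition fps_one : fps A := FPS (fun n => (n == 0%N)%:R).
Definition fps_opp f : fps A := FPS (fun n => - fps_coef f n).
Definition fps_add f g : fps A := FPS (fun n => fps_coef f n + fps_coef g n).
Definition fps_mul f g : fps A :=
  FPS (fun n => \sum_(j < n.+1) fps_coef f j * fps_coef g (n - j)).

Lemma fps_addA : associative fps_add.
Proof. by move=> f g h; apply: fpsP => n /=; rewrite addrA. Qed.
Lemma fps_addC : commutative fps_add.
Proof. by move=> f g; apply: fpsP => n /=; rewrite addrC. Qed.
Lemma fps_add0 : left_id fps_zero fps_add.
Proof. by move=> f; apply: fpsP => n /=; rewrite add0r. Qed.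
Lemma fps_addN : left_inverse fps_zero fps_opp fps_add.
Proof. by move=> f; apply: fpsP => n /=; rewrite addNr. Qed.

HB.instance Definition _ :=
  GRing.isZmodule.Build (fps A) fps_addA fps_addC fps_add0 fps_addN.

Definition fps_trunc N f : {poly A} := \poly_(i < N) fps_coef f i.

Lemma fps_coef_trunc N f n : (n < N)%N -> (fps_trunc N f)`_n = fps_coef f n.
Proof. by move=> nN; rewrite coef_poly nN. Qed.

Lemma fps_mul_trunc N f g n : (n < N)%N ->
  fps_coef (fps_mul f g) n = (fps_trunc N f * fps_trunc N g)`_n.
Proof.
move=> nN; rewrite coefM; apply: eq_bigr => j _.
rewrite !fps_coef_trunc //; first exact: leq_ltn_trans (leq_subr _ _) nN.
exact: leq_trans (ltn_ord j) nN.
Qed.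

Lemma fps_mulA : associative fps_mul.
Proof.
move=> f g h; apply: fpsP => n.
have -> : fps_coef (fps_mul f (fps_mul g h)) n =
    (fps_trunc n.+1 f * (fps_trunc n.+1 g * fps_trunc n.+1 h))`_n.
  rewrite coefM; apply: eq_bigr => j _.
  rewrite (@fps_mul_trunc n.+1) ?fps_coef_trunc //.
  by rewrite ltnS leq_subr.
rewrite mulrA coefM; apply: eq_bigr => j _.
rewrite (@fps_mul_trunc n.+1) ?fps_coef_trunc //.
by rewrite ltnS leq_subr.
Qed.

Lemma fps_mulC : commutative fps_mul.
Proof.
by move=> f g; apply: fpsP => n; rewrite !(@fps_mul_trunc n.+1) // mulrC.
Qed.

Lemma fps_mul1 : left_id fps_one fps_mul.
Proof.
move=> f; apply: fpsP => n /=.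
by rewrite big_ord_recl /= mul1r subn0 big1 ?addr0 // => j _; rewrite mul0r.
Qed.

Lemma fps_mulDl : left_distributive fps_mul fps_add.
Proof.
move=> f g h; apply: fpsP => n /=; rewrite -big_split.
by apply: eq_bigr => j _; rewrite mulrDl.
Qed.

Lemma fps_one_neq0 : fps_one != fps_zero.
Proof.
apply/eqP => /(congr1 (fun f => fps_coef f 0)) /= /eqP.
by rewrite oner_eq0.
Qed.

HB.instance Definition _ := GRing.Zmodule_isComNzRing.Build (fps A)
  fps_mulA fps_mulC fps_mul1 fps_mulDl fps_one_neq0.

Lemma fps_coef0 n : fps_coef (0 : fps A) n = 0. Proof. by []. Qed.
Lemma fps_coef1 n : fps_coef (1 : fps A) n = (n == 0%N)%:R. Proof. by []. Qed.
Lemma fps_coefN f n : fps_coef (- f) n = - fps_coef f n. Proof. by []. Qed.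
Lemma fps_coefD f g n : fps_coef (f + g) n = fps_coef f n + fps_coef g n.
Proof. by []. Qed.
Lemma fps_coefM f g n :
  fps_coef (f * g) n = \sum_(j < n.+1) fps_coef f j * fps_coef g (n - j).
Proof. by []. Qed.
Lemma fps_coef_sum I (s : seq I) (P : pred I) (F : I -> fps A) n :
  fps_coef (\sum_(i <- s | P i) F i) n = \sum_(i <- s | P i) fps_coef (F i) n.
Proof. by apply: (big_morph (fun f => fps_coef f n)). Qed.

Lemma fps_coefX_lt f k n :
  fps_coef f 0 = 0 -> (n < k)%N -> fps_coef (f ^+ k) n = 0.
Proof.
move=> f0; elim: k n => // k IH n nk; rewrite exprS fps_coefM big1 // => j _.
have [j0|j0] := posnP j; first by rewrite j0 f0 mul0r.
by rewrite IH ?mulr0 //; case: n j nk j0 => [|n] [[|j] lj] //= nk _;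
  rewrite subSS (leq_ltn_trans (leq_subr _ _)).
Qed.

Definition fpsC (a : A) : fps A := FPS (fun n => if n == 0%N then a else 0).

Lemma fps_coefCM a f n : fps_coef (fpsC a * f) n = a * fps_coef f n.
Proof.
rewrite fps_coefM big_ord_recl /= subn0 big1 ?addr0 // => j _.
by rewrite mul0r.
Qed.

Definition fpsX : fps A := FPS (fun n => (n == 1%N)%:R).

(* The composite f(g(t)), meaningful when g has zero constant term: then      *)
(* g ^+ k has no coefficient of degree n < k, so the sum over k may stop at n.*)
Definition fps_comp f g : fps A :=
  FPS (fun n => \sum_(k < n.+1) fps_coef f k * fps_coef (g ^+ k) n).

End FpsRing.

Section FpsUnitRing.
Variable A : comUnitRingType.
Implicit Types f g : fps A.

Definition fps_unit : {pred fps A} :=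
  fun f => fps_coef f 0 \is a GRing.unit.

(* With a the constant term of f, 1 / f = a^-1 * \sum_k (1 - a^-1 * f) ^+ k. *)
Definition fps_inv f : fps A :=
  if fps_coef f 0 \is a GRing.unit then
    let a' := fpsC (fps_coef f 0)^-1 in
    FPS (fun n => fps_coef (a' * \sum_(k < n.+1) (1 - a' * f) ^+ k) n)
  else f.

Lemma fps_mulVx : {in fps_unit, left_inverse 1 fps_inv *%R}.
Proof.
move=> f; rewrite -topredE /= => uf; rewrite /fps_inv (uf : _ \is a _).
set a' := fpsC _; set u := 1 - a' * f.
have u0 : fps_coef u 0 = 0.
  by rewrite fps_coefD fps_coefN fps_coefCM mulVr // subrr.
apply: fpsP => n; set g := FPS _.
have gE i : (i < n.+1)%N ->
    fps_coef g i = fps_coef (a' * \sum_(k < n.+1) u ^+ k) i.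
  move=> lein.
  rewrite (_ : fps_coef g i = fps_coef (a' * \sum_(k < i.+1) u ^+ k) i) //.
  rewrite !fps_coefCM; congr (_ * _); rewrite !fps_coef_sum.
  rewrite (big_ord_widen n.+1 (fun k => fps_coef (u ^+ k) i)) //.
  rewrite big_mkcond; apply: eq_bigr => k _; case: ifPn => //.
  by rewrite -leqNgt => ik; rewrite fps_coefX_lt.
have -> : fps_coef (g * f) n = fps_coef (a' * (\sum_(k < n.+1) u ^+ k) * f) n.
  by rewrite !fps_coefM; apply: eq_bigr => j _; rewrite gE.
have -> : a' * (\sum_(k < n.+1) u ^+ k) * f = 1 - u ^+ n.+1.
  have -> : a' * (\sum_(k < n.+1) u ^+ k) * f = (1 - u) * \sum_(k < n.+1) u ^+ k.
    by rewrite mulrAC [1 - u]subKr.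
  by rewrite -[1 - u]opprB mulNr -subrX1 opprB.
by rewrite fps_coefD fps_coefN fps_coefX_lt // subr0.
Qed.

Lemma fps_unitPl f g : g * f = 1 -> fps_unit f.
Proof.
move=> /(congr1 (fun h => fps_coef h 0)).
rewrite fps_coefM big_ord1 subnn /= => gf1.
by apply/unitrPr; exists (fps_coef g 0); rewrite mulrC.
Qed.

Lemma fps_inv_out : {in [predC fps_unit], fps_inv =1 id}.
Proof. by move=> f; rewrite inE /fps_inv => /negbTE uf; rewrite [_ \is a _]uf. Qed.

HB.instance Definition _ := GRing.ComNzRing_hasMulInverse.Build (fps A)
  fps_mulVx fps_unitPl fps_inv_out.

(* The degenerate falling factorial (x)_{n,l}. *)
Definition dfall (l x : A) (n : nat) : A := \prod_(i < n) (x - i%:R * l).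

(* e_l^x(t) = (1 + l t)^(x / l), taken as its formal binomial series in t,    *)
(* since binom(x / l, n) l^n = (x)_{n,l} / n!; n! must be invertible in A.    *)
Definition dexp (l x : A) : fps A := FPS (fun n => dfall l x n / n`!%:R).

End FpsUnitRing.

(* The indeterminate x of the polynomials is 'X : {poly R}, so the generating *)
(* functions are power series in t over {poly R}, and l is embedded as l%:P.  *)
Section Polynomials.
Variable R : realType.

Definition dHermite (l : R) (n : nat) : {poly R} :=
  n`!%:R * fps_coef (fps_comp (dexp l%:P (-1)) (fpsX {poly R} ^+ 2) *
                     fps_comp (dexp l%:P 'X) (2 * fpsX {poly R})) n.

Definition dEuler (l : R) (r n : nat) : {poly R} :=
  n`!%:R * fps_coef ((2 / (dexp l%:P 1 + 1)) ^+ r * dexp l%:P 'X) n.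

Definition dEuler_number (l : R) (r n : nat) : R := (dEuler l r n).[0].

End Polynomials.

(* Main.v *)
(** Writing [S = e_l(t^2)] and [G = (2 / (e_l(t) + 1))^r], the addition law of
    the degenerate exponentials gives [e_l^x(2t) = S * H], where [H] is the
    generating function of the Hermite polynomials.  Substituting [t / 2] for
    [t] and multiplying by [G] gives [G * e_l^x(t) = H(t/2) * (S(t/2) * G)],
    whose coefficients are the two sides of the identity, since [G] is the
    generating function of the Euler numbers. *)
From HB Require Import structures.
Require Import Defs.
From mathcomp Require Import all_boot all_order all_algebra.
From mathcomp Require Import reals.
From mathcomp Require Import ring.

Set Implicit Arguments.
Unset Strict Implicit.
Unset Printing Implicit Defensive.

Import Order.TTheory GRing.Theory Num.Theory.
Local Open Scope ring_scope.

(** * Change of coefficient ring in power series *)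

Section FpsMap.
Variables (A B : comNzRingType) (phi : {rmorphism A -> B}).

Definition fps_map (f : fps A) : fps B := FPS (fun n => phi (fps_coef f n)).

Lemma fps_map_is_zmod_morphism : zmod_morphism fps_map.
Proof. by move=> f g; apply: fpsP => n; apply: rmorphB. Qed.

Lemma fps_map_is_monoid_morphism : monoid_morphism fps_map.
Proof.
split=> [|f g]; apply: fpsP => n; first exact: rmorph_nat.
by rewrite [LHS]rmorph_sum; apply: eq_bigr => j _; rewrite rmorphM.
Qed.

HB.instance Definition _ :=
  GRing.isZmodMorphism.Build (fps A) (fps B) fps_map fps_map_is_zmod_morphism.
HB.instance Definition _ :=
  GRing.isMonoidMorphism.Build (fps A) (fps B) fps_map
    fps_map_is_monoid_morphism.

End FpsMap.

(** * Composition of power series *)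

Section FpsComp.
Variable A : comNzRingType.
Implicit Types (f g h : fps A) (p : {poly A}).

Lemma fpsC_is_zmod_morphism : zmod_morphism (@fpsC A).
Proof.
by move=> a b; apply: fpsP => -[|n] //; rewrite fps_coefD fps_coefN /= subr0.
Qed.

Lemma fpsC_is_monoid_morphism : monoid_morphism (@fpsC A).
Proof.
split=> [|a b]; apply: fpsP => -[|n] //; rewrite fps_coefCM //=.
by rewrite mulr0.
Qed.

HB.instance Definition _ :=
  GRing.isZmodMorphism.Build A (fps A) (@fpsC A) fpsC_is_zmod_morphism.
HB.instance Definition _ :=
  GRing.isMonoidMorphism.Build A (fps A) (@fpsC A) fpsC_is_monoid_morphism.

Lemma fps_coef_fpsXn k n : fps_coef (fpsX A ^+ k) n = (n == k)%:R.
Proof.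
elim: k n => [|k IH] n //; rewrite exprS fps_coefM.
case: n => [|n]; first by rewrite big_ord1 mul0r.
rewrite 2!big_ord_recl big1 /= => [|j _]; last by rewrite mul0r.
by rewrite mul0r add0r addr0 mul1r subSS subn0 IH eqSS.
Qed.

(** Since [g ^+ k] has no coefficient of degree below [k], the coefficients of [p] beyond [n] are
    irrelevant. Composition thus reduces, degree by degree, to evaluating a polynomial at [g]. *)
Lemma fps_coef_comp_poly f g p n : fps_coef g 0 = 0 ->
    (forall i, (i <= n)%N -> p`_i = fps_coef f i) ->
  fps_coef (fps_comp f g) n = fps_coef (map_poly (@fpsC A) p).[g] n.
Proof.
move=> g0 pf; have fC0 : fpsC (0 : A) = 0 by apply: rmorph0.
(* Both sums are extended to a common range; the terms with [k > n] vanish. *)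
rewrite (@horner_coef_wide _ (maxn n.+1 (size p))); last first.
  by rewrite (leq_trans (size_poly _ _)) // leq_maxr.
rewrite fps_coef_sum [LHS]/= (big_ord_widen (maxn n.+1 (size p)) (fun k =>
  fps_coef f k * fps_coef (g ^+ k) n)) ?leq_maxl //.
rewrite big_mkcond; apply: eq_bigr => k _.
rewrite coef_map_id0 // fps_coefCM; case: ifPn => [kn|]; first by rewrite pf.
by rewrite -leqNgt => nk; rewrite fps_coefX_lt ?mulr0.
Qed.

Lemma fps_comp1 g : fps_coef g 0 = 0 -> fps_comp 1 g = 1.
Proof.
move=> g0; apply: fpsP => n; rewrite (@fps_coef_comp_poly _ _ 1) //.
  by rewrite rmorph1 hornerC.
by move=> i _; rewrite coef1 fps_coef1.
Qed.

(** In degree [n] both factors may be truncated, and evaluation of polynomials at [g] is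
    multiplicative. *)
Lemma fps_compM f h g : fps_coef g 0 = 0 ->
  fps_comp (f * h) g = fps_comp f g * fps_comp h g.
Proof.
move=> g0; apply: fpsP => n.
rewrite (@fps_coef_comp_poly _ _ (fps_trunc n.+1 f * fps_trunc n.+1 h)) //.
  rewrite rmorphM hornerM !fps_coefM; apply: eq_bigr => j _.
  rewrite (@fps_coef_comp_poly _ _ (fps_trunc n.+1 f)) //; last first.
    by move=> i ij; rewrite fps_coef_trunc // (leq_ltn_trans ij).
  rewrite (@fps_coef_comp_poly _ _ (fps_trunc n.+1 h)) // => i ij.
  by rewrite fps_coef_trunc // ltnS (leq_trans ij) ?leq_subr.
by move=> i lein; rewrite -fps_mul_trunc.
Qed.

Lemma fps_coef_comp_scale c f n :
  fps_coef (fps_comp f (fpsC c * fpsX A)) n = c ^+ n * fps_coef f n.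
Proof.
rewrite /= (bigD1 ord_max) //= big1 => [|k].
  by rewrite exprMn -rmorphXn fps_coefCM fps_coef_fpsXn eqxx mulr1 addr0 mulrC.
rewrite -val_eqE /= eq_sym => /negbTE nk.
by rewrite exprMn -rmorphXn fps_coefCM fps_coef_fpsXn nk !mulr0.
Qed.

Lemma fps_coef_comp_sqr f n :
  fps_coef (fps_comp f (fpsX A ^+ 2)) n
    = if odd n then 0 else fps_coef f n./2.
Proof.
rewrite /=; case: ifPn => [on|en].
  rewrite big1 // => k _; rewrite -exprM fps_coef_fpsXn.
  case: eqP => [nk|_]; last by rewrite mulr0.
  by rewrite nk oddM in on.
have hn : (n./2 < n.+1)%N by rewrite ltnS -leq_double even_halfK // -addnn leq_addr.
rewrite (bigD1 (Ordinal hn)) //= big1 => [|k].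
  by rewrite -exprM fps_coef_fpsXn mul2n even_halfK // eqxx mulr1 addr0.
rewrite -val_eqE /= => nk; rewrite -exprM fps_coef_fpsXn mul2n.
case: eqP => [nE|_]; last by rewrite mulr0.
by rewrite [in X in _ != X]nE doubleK eqxx in nk.
Qed.

End FpsComp.

(** * Addition law of the degenerate exponentials, where positive integers are units *)

Section DegenerateExponential.
Variable A : comUnitRingType.
Hypothesis natU : forall n, n.+1%:R \is a @GRing.unit A.
Implicit Types (l x y : A).

Lemma fact_unit n : n`!%:R \is a @GRing.unit A.
Proof. by rewrite -(prednK (fact_gt0 n)). Qed.

Lemma dfallS l x n : dfall l x n.+1 = dfall l x n * (x - n%:R * l).
Proof. exact: big_ord_recr. Qed.

Lemma dexp_recr l x n :
  n.+1%:R * fps_coef (dexp l x) n.+1 = (x - n%:R * l) * fps_coef (dexp l x) n.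
Proof.
rewrite /= dfallS factS natrM invrM ?fact_unit //.
by rewrite [LHS]mulrC !mulrA divrK // [dfall l x n * _]mulrC.
Qed.

(* Both sides are determined by the recurrence
   [n.+1 * c_n.+1 = (x + y - n * l) * c_n]. *)
Lemma dexpD l x y : dexp l (x + y) = dexp l x * dexp l y.
Proof.
apply: fpsP; elim=> [|n IH].
  by rewrite fps_coefM big_ord1 /= /dfall !big_ord0 divr1 mulr1.
apply: (mulrI (natU n)); rewrite dexp_recr IH !fps_coefM !mulr_sumr.
pose a j := fps_coef (dexp l x) j; pose b j := fps_coef (dexp l y) j.
have aS j : j.+1%:R * a j.+1 = (x - j%:R * l) * a j by apply: dexp_recr.
have bS j : j.+1%:R * b j.+1 = (y - j%:R * l) * b j by apply: dexp_recr.
have natrE m i : (i <= m)%N -> m%:R = i%:R + (m - i)%:R :> A.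
  by move=> im; rewrite -natrD subnKC.
(* Leibniz rule: the factor [n.+1] is split as [j + (n.+1 - j)] in each term. *)
transitivity (\sum_(j < n.+2) (j%:R * a j * b (n.+1 - j)%N
                 + a j * ((n.+1 - j)%:R * b (n.+1 - j)%N))); last first.
  apply: eq_bigr => j _; rewrite (natrE n.+1 j); last by rewrite -ltnS.
  by rewrite -/(a j * b (n.+1 - j)%N) [a j * (_ * b _)]mulrCA -mulrA -mulrDl.
rewrite -[LHS]/(\sum_(j < n.+1) (x + y - n%:R * l) * (a j * b (n - j)%N)).
(* The first sum loses its term [j = 0], the second its term [j = n.+1]; after the shift both run
   over [j < n.+1]. *)
clearbody a b; rewrite big_split [X in _ = X + _]big_ord_recl /= !mul0r add0r.
rewrite [X in _ = _ + X]big_ord_recr.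
rewrite /= subnn mul0r mulr0 addr0 -big_split; apply: eq_bigr => j _ /=.
have jn : (j <= n)%N by rewrite -ltnS.
(* The recurrences leave [(x - j * l) + (y - (n - j) * l) = x + y - n * l]. *)
rewrite /bump add1n subSS subSn // aS bS (natrE n j) //.
by move: j%:R (n - j)%:R => u v; ring.
Qed.

Lemma dexp0 l : dexp l 0 = 1.
Proof.
apply: fpsP => -[|n] /=; rewrite /dfall ?big_ord0 ?divr1 //.
by rewrite big_ord_recl mul0r subrr !mul0r.
Qed.

Lemma fps_coef0_dexp l x : fps_coef (dexp l x) 0 = 1.
Proof. by rewrite /= /dfall big_ord0 divr1. Qed.

(** The constant term is 2, a unit. *)
Lemma dexp1D1_unit l : dexp l 1 + 1 \is a GRing.unit.
Proof.
rewrite [_ \is a _]/(fps_coef _ 0 \is a _) fps_coefD fps_coef0_dexp.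
exact: (natU 1).
Qed.

End DegenerateExponential.

Section DegenerateExponentialMap.
Variables (A B : comUnitRingType) (phi : {rmorphism A -> B}).
Hypothesis natU : forall n, n.+1%:R \is a @GRing.unit A.

Lemma fps_map_dexp (l x : A) : fps_map phi (dexp l x) = dexp (phi l) (phi x).
Proof.
apply: fpsP => n /=; rewrite rmorph_div ?fact_unit // rmorph_nat.
congr (_ / _); rewrite rmorph_prod; apply: eq_bigr => j _.
by rewrite rmorphB rmorphM rmorph_nat.
Qed.

Lemma fps_map_Euler_gf (l : A) r :
  fps_map phi ((2 / (dexp l 1 + 1)) ^+ r) = (2 / (dexp (phi l) 1 + 1)) ^+ r.
Proof.
rewrite rmorphXn rmorph_div ?dexp1D1_unit // rmorph_nat.
by rewrite rmorphD rmorph1 /= fps_map_dexp rmorph1.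
Qed.

End DegenerateExponentialMap.

(** * Generating functions of the Euler numbers and Hermite polynomials *)

Section Polynomials.
Variable R : realType.
Implicit Type l : R.

Lemma natr_unit n : n.+1%:R \is a @GRing.unit R.
Proof. by rewrite unitfE pnatr_eq0. Qed.

Lemma polyC_natr_unit n : n.+1%:R \is a @GRing.unit {poly R}.
Proof. by rewrite -polyC_natr rmorph_unit ?natr_unit. Qed.

(** Evaluation at [x = 0] acts coefficientwise as a ring morphism and sends [e_l^x(t)] to 1. *)
Lemma dEuler_numberE l r n :
  dEuler_number l r n
    = n`!%:R * fps_coef ((2 / (dexp l 1 + 1)) ^+ r) n.
Proof.
pose ev : {rmorphism {poly R} -> R} := horner_eval 0.
transitivity (n`!%:R * fps_coef (fps_map ev
    ((2 / (dexp l%:P 1 + 1)) ^+ r * dexp l%:P 'X)) n).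
  by rewrite /dEuler_number /dEuler -polyC_natr hornerM hornerC.
have evU := polyC_natr_unit.
congr (_ * fps_coef _ _); rewrite rmorphM /= fps_map_Euler_gf // fps_map_dexp //.
by rewrite [ev _]hornerC [ev _]hornerX dexp0 mulr1.
Qed.

(** The series does not involve [x]: it is the image under [polyC] of a series over [R]. *)
Lemma fps_coef_Euler_gf l r n :
  fps_coef ((2 / (dexp l%:P 1 + 1)) ^+ r) n
    = (dEuler_number l r n / n`!%:R)%:P.
Proof.
rewrite dEuler_numberE mulrAC divff ?mul1r; last first.
  by rewrite pnatr_eq0 -lt0n fact_gt0.
by rewrite -(fps_map_Euler_gf (@polyC R) natr_unit).
Qed.

Definition Hermite_gf l : fps {poly R} :=
  fps_comp (dexp l%:P (-1)) (fpsX {poly R} ^+ 2) *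
  fps_comp (dexp l%:P 'X) (2 * fpsX {poly R}).

Lemma fps_coef_Hermite_gf l n :
  fps_coef (Hermite_gf l) n = n`!%:R^-1 *: dHermite l n.
Proof.
rewrite /dHermite -polyC_natr mul_polyC scalerA mulVf ?scale1r //.
by rewrite pnatr_eq0 -lt0n fact_gt0.
Qed.

(** By the addition law, [e_l(t^2)] cancels the factor [e_l^{-1}(t^2)] of [Hermite_gf]. *)
Lemma comp_dexpX_Hermite_gf l :
  fps_comp (dexp l%:P 'X) (2 * fpsX {poly R})
    = fps_comp (dexp l%:P 1) (fpsX {poly R} ^+ 2) * Hermite_gf l.
Proof.
have X0 : fps_coef (fpsX {poly R} ^+ 2) 0 = 0 by rewrite fps_coef_fpsXn.
rewrite mulrA -fps_compM // -(dexpD polyC_natr_unit) subrr dexp0.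
by rewrite fps_comp1 // mul1r.
Qed.

(** Substituting [t / 2] for [t] undoes the scaling by 2 in [e_l^x(2t)]. *)
Lemma dexpX_Hermite_gf l (h := fpsC (2^-1)%:P * fpsX {poly R}) :
  dexp l%:P 'X
    = fps_comp (fps_comp (dexp l%:P 1) (fpsX {poly R} ^+ 2)) h
      * fps_comp (Hermite_gf l) h.
Proof.
rewrite -fps_compM ?fps_coefCM ?mulr0 // -comp_dexpX_Hermite_gf.
have -> : (2 : fps {poly R}) = fpsC 2 by rewrite rmorph_nat.
apply: fpsP => n; rewrite !fps_coef_comp_scale mulrA -exprMn.
by rewrite -polyC_natr -polyCM mulVf ?pnatr_eq0 // expr1n mul1r.
Qed.

Lemma fps_coef_dexp_polyC l (x : R) n :
  fps_coef (dexp l%:P x%:P) n = (dfall l x n / n`!%:R)%:P.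
Proof. by rewrite -(fps_map_dexp (@polyC R) natr_unit). Qed.

End Polynomials.

Theorem theorem2 (R : realType) (lambda : R) (hlambda : lambda != 0)
    (r : nat) (hr : (0 < r)%N) (n : nat) :
  dEuler lambda r n =
    n`!%:R *:
      \sum_(0 <= k < n.+1)
        (\sum_(0 <= l < (n - k).+1 | ~~ odd l)
           dfall lambda 1 l./2
             / (k`!%:R * (n - k - l)`!%:R * 2 ^+ (l + k) * (l./2)`!%:R)
             * dEuler_number lambda r (n - k - l))
        *: dHermite lambda k.
Proof.
rewrite /dEuler -polyC_natr mul_polyC; congr (_ *: _).
(* With the Hermite factor first, the convolution index is the [k] of the statement; the inner index
   [l] is then the degree in [e_l((t/2)^2)]. *)
rewrite dexpX_Hermite_gf mulrCA mulrA mulrC fps_coefM big_mkord.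
apply: eq_bigr => k _; rewrite fps_coef_comp_scale fps_coef_Hermite_gf.
rewrite -polyC_exp mul_polyC scalerA -scalerAl fps_coefM.
rewrite big_mkord [in RHS]big_mkcond scaler_suml mulr_sumr scaler_sumr.
(* Odd [l] contribute nothing, as [e_l(t^2)] is a series in [t^2]. *)
apply: eq_bigr => l _; rewrite fps_coef_comp_scale fps_coef_comp_sqr.
rewrite fps_coef_Euler_gf -polyC_exp; case: ifPn => [_|_].
  by rewrite mulr0 mul0r mulr0 scaler0 scale0r.
rewrite fps_coef_dexp_polyC -!polyCM [dHermite _ _ * _]mulrC mul_polyC scalerA; congr (_ *: _).
(* The two substitutions of [t / 2] supply [2^-k] and [2^-l]; the inverses are generalized so that
   only commutative algebra remains. *)
rewrite exprD !invfM !exprVn.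
move: (k`!%:R^-1) ((n - k - l)`!%:R^-1) ((2 ^+ k)^-1) ((2 ^+ l)^-1) => a b c d.
by ring.
Qed.
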